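(* For every $\varepsilon>0$ and all integers $m\ge n\ge 2$ there is a convex, centrally symmetric (about the origin), compact set $K=K(\varepsilon,n,m)\subset \ell_2$ such that $$d_n(K)_{\ell_2}<\varepsilon\qquad\text{and}\qquad d_m^c(K)_{\ell_2}>1.$$
   Context: For a compact set $K$ in a Banach space $X$ and $n\ge 1$, the Kolmogorov width and the constrained Kolmogorov width of $K$ are $$d_n(K)_X:=\inf_{\dim V\le n}\ \sup_{f\in K}\ \inf_{v\in V}\|f-v\|_X,\qquad d_n^c(K)_X:=\inf_{\dim V\le n}\ \sup_{f\in K}\ \inf_{v\in V\cap K}\|f-v\|_X,$$ where the outer infima are over linear subspaces $V\subset X$ of dimension at most $n$. Here $\ell_2$ is the usual Hilbert space of square-summable real sequences. *)

(* Defs.v *)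
From HB Require Import structures.
From mathcomp Require Import all_boot all_order all_algebra.
From mathcomp Require Import all_classical all_reals all_analysis.
From mathcomp Require Import ring lra.

Set Implicit Arguments.
Unset Strict Implicit.
Unset Printing Implicit Defensive.

Import Order.TTheory GRing.Theory Num.Theory.
Import numFieldNormedType.Exports.

Local Open Scope classical_set_scope.
Local Open Scope ring_scope.

Section Ell2.
Context {R : realType}.
Implicit Types u v : nat -> R.

Definition sqseries u : R ^nat := series (fun k => u k ^+ 2).

Definition square_summable : {pred nat -> R} :=
  fun u => `[< cvgn (sqseries u) >].

Definition ell2_norm u : R := Num.sqrt (limn (sqseries u)).

Lemma square_summableP u : reflect (cvgn (sqseries u)) (u \in square_summable).
Proof. exact: asboolP. Qed.

Lemma sqseries_nd u : {homo sqseries u : m n / (m <= n)%N >-> m <= n}.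
Proof. by apply: nondecreasing_series => k _ _; exact: sqr_ge0. Qed.

Lemma sqseries_le_lim u k : u \in square_summable ->
  sqseries u k <= limn (sqseries u).
Proof.
move=> /square_summableP cu; apply: nondecreasing_cvgn_le => //.
exact: sqseries_nd.
Qed.

Lemma sqseries_ge0 u k : 0 <= sqseries u k.
Proof. by apply: sumr_ge0 => i _; exact: sqr_ge0. Qed.

Lemma lim_sqseries_ge0 u : u \in square_summable -> 0 <= limn (sqseries u).
Proof. by move=> su; exact: le_trans (sqseries_ge0 u 0) (sqseries_le_lim 0 su). Qed.

Lemma coord_le_ell2_norm u k : u \in square_summable -> `|u k| <= ell2_norm u.
Proof.
move=> su; rewrite -sqrtr_sqr; apply: ler_wsqrtr.
apply: le_trans (sqseries_le_lim k.+1 su).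
by rewrite /sqseries seriesSr lerDr; exact: sqseries_ge0.
Qed.

Lemma sqseries_bounded u (M : R) : (forall n, sqseries u n <= M) ->
  u \in square_summable /\ limn (sqseries u) <= M.
Proof.
move=> uM; have cu : cvgn (sqseries u).
  by apply: (nondecreasing_is_cvgn (@sqseries_nd u)); exists M => _ [n _ <-].
by split; [exact/square_summableP | apply: limr_le => //; exact: nearW].
Qed.

Lemma sqseries_scale a u n : sqseries (a *: u) n = a ^+ 2 * sqseries u n.
Proof.
by rewrite /sqseries /series/= mulr_sumr; apply: eq_bigr => i _; rewrite exprMn.
Qed.

Lemma lim_sqseries_scale a u : u \in square_summable ->
  (a *: u) \in square_summable /\
  limn (sqseries (a *: u)) = a ^+ 2 * limn (sqseries u).
Proof.
move=> /square_summableP cu.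
have E : sqseries (a *: u) = (fun n => a ^+ 2 * sqseries u n).
  by apply/funext => n; exact: sqseries_scale.
have C : sqseries (a *: u) @ \oo --> a ^+ 2 * limn (sqseries u).
  by rewrite E; apply: cvgM => //; exact: cvg_cst.
by split; [apply/square_summableP/cvg_ex; eexists; exact: C | exact/cvg_lim].
Qed.

(* Young's inequality, with a weight that is optimised in [ell2_normD] *)
Lemma sqseriesD_le u v (t : R) n : 0 < t ->
  sqseries (u + v) n <= (1 + t) * sqseries u n + (1 + t^-1) * sqseries v n.
Proof.
move=> t0; rewrite /sqseries /series/= !mulr_sumr -big_split/=.
apply: ler_sum => i _; rewrite -subr_ge0.
have -> : (1 + t) * u i ^+ 2 + (1 + t^-1) * v i ^+ 2 - ((u + v) i) ^+ 2
    = t^-1 * (t * u i - v i) ^+ 2.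
  by rewrite !fctE; field; rewrite gt_eqF.
by rewrite mulr_ge0 ?sqr_ge0// invr_ge0 ltW.
Qed.

Lemma square_summableD u v : u \in square_summable -> v \in square_summable ->
  u + v \in square_summable.
Proof.
move=> su sv.
have [] := @sqseries_bounded (u + v)
  ((1 + 1) * limn (sqseries u) + (1 + 1^-1) * limn (sqseries v)) => // n.
apply: le_trans (sqseriesD_le u v n ltr01) _.
by rewrite lerD// ler_wpM2l ?sqseries_le_lim// ?invr1 ?addr_ge0.
Qed.

Lemma ell2_norm_ge0 u : 0 <= ell2_norm u.
Proof. exact: sqrtr_ge0. Qed.

Lemma ell2_norm_sqr u : u \in square_summable ->
  ell2_norm u ^+ 2 = limn (sqseries u).
Proof. by move=> su; rewrite sqr_sqrtr// lim_sqseries_ge0. Qed.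

Lemma ell2_norm0_eq0 u : u \in square_summable -> ell2_norm u = 0 -> u = 0.
Proof.
move=> su u0; apply/funext => k; apply/eqP; rewrite -normr_le0 -u0.
exact: coord_le_ell2_norm.
Qed.

Lemma ell2_normD u v : u \in square_summable -> v \in square_summable ->
  ell2_norm (u + v) <= ell2_norm u + ell2_norm v.
Proof.
move=> su sv.
have [u0|u0] := eqVneq (ell2_norm u) 0.
  by rewrite u0 (ell2_norm0_eq0 su u0) !add0r.
have [v0|v0] := eqVneq (ell2_norm v) 0.
  by rewrite v0 (ell2_norm0_eq0 sv v0) !addr0.
have {}u0 : 0 < ell2_norm u by rewrite lt_def u0 ell2_norm_ge0.
have {}v0 : 0 < ell2_norm v by rewrite lt_def v0 ell2_norm_ge0.
rewrite -[leRHS]ger0_norm ?addr_ge0 ?ell2_norm_ge0// -sqrtr_sqr.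
apply: ler_wsqrtr.
have [] // := @sqseries_bounded (u + v) ((ell2_norm u + ell2_norm v) ^+ 2) => n.
apply: le_trans (sqseriesD_le u v n (divr_gt0 v0 u0)) _.
have -> : (ell2_norm u + ell2_norm v) ^+ 2 =
    (1 + ell2_norm v / ell2_norm u) * ell2_norm u ^+ 2 +
    (1 + (ell2_norm v / ell2_norm u)^-1) * ell2_norm v ^+ 2.
  by field; rewrite ?gt_eqF.
by rewrite !ell2_norm_sqr// lerD// ler_wpM2l ?sqseries_le_lim//
  addr_ge0// ?invr_ge0 divr_ge0// ltW.
Qed.

Lemma square_summable_submod_closed : submod_closed square_summable.
Proof.
split=> [|a u v su sv].
  have [] // := @sqseries_bounded 0 0 => n.
  by rewrite /sqseries /series/= big1// => i _; rewrite expr0n.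
by apply: square_summableD => //; have [] := lim_sqseries_scale a su.
Qed.

HB.instance Definition _ :=
  GRing.isSubmodClosed.Build R (nat -> R) square_summable
    square_summable_submod_closed.

End Ell2.

Record ell2 (R : realType) := Ell2 {
  ell2_seq :> nat -> R;
  ell2P : ell2_seq \in square_summable }.

Section Ell2Type.
Context (R : realType).

HB.instance Definition _ := [isSub for @ell2_seq R].
HB.instance Definition _ := [Choice of ell2 R by <:].
HB.instance Definition _ := [SubChoice_isSubLmodule of ell2 R by <:].

Let normD (x y : ell2 R) :
  ell2_norm (x + y : ell2 R) <= ell2_norm x + ell2_norm y.
Proof. exact: ell2_normD (ell2P x) (ell2P y). Qed.

Let normZ (a : R) (x : ell2 R) :
  ell2_norm (a *: x : ell2 R) = `|a| * ell2_norm x.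
Proof.
rewrite /ell2_norm (lim_sqseries_scale a (ell2P x)).2.
by rewrite sqrtrM ?sqr_ge0// sqrtr_sqr.
Qed.

Let norm0_eq0 (x : ell2 R) : ell2_norm x = 0 -> x = 0.
Proof. by move=> x0; apply/val_inj/(ell2_norm0_eq0 (ell2P x)). Qed.

HB.instance Definition _ :=
  Lmodule_isNormed.Build R (ell2 R) normD normZ norm0_eq0.

Lemma ell2_normE (x : ell2 R) : `|x| = ell2_norm x.
Proof. by []. Qed.

Let ell2_complete (F : set_system (ell2 R)) :
  ProperFilter F -> cauchy F -> cvg F.
Proof.
move=> FF /cauchyP Fc.
have coord k : cvg ((x : ell2 R) k @[x --> F]).
  apply: cauchy_cvg; apply/cauchyP => e e0.
  have [x Fx] := Fc e e0; exists (x k).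
  rewrite /= /fmap/=; apply: filterS Fx => y; rewrite -ball_normE/= => xy.
  apply: le_lt_trans xy.
  exact: (coord_le_ell2_norm k (ell2P (x - y))).
pose l k := lim ((x : ell2 R) k @[x --> F]).
have near_l (e : R) (x : ell2 R) : 0 < e -> F (ball x e) ->
    forall n, sqseries (ell2_seq x - l) n <= e ^+ 2.
  move=> e0 Fx n.
  have C : sqseries (ell2_seq x - ell2_seq y) n @[y --> F] -->
      sqseries (ell2_seq x - l) n.
    elim: n => [|n IH].
      by rewrite /sqseries /series/= big_geq//; under eq_fun do rewrite big_geq//;
        exact: cvg_cst.
    rewrite /sqseries seriesSr; under eq_fun do rewrite seriesSr.
    apply: cvgD; first exact: IH.
    by rewrite !expr2; apply: cvgM; apply: cvgB; (exact: cvg_cst || exact: coord).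
  rewrite -(cvg_lim _ C)//; apply: limr_le; first by apply/cvg_ex; eexists; exact: C.
  apply: filterS Fx => y; rewrite -ball_normE/= ell2_normE => xy.
  apply: le_trans (sqseries_le_lim n (ell2P (x - y))) _.
  rewrite -ell2_norm_sqr ?ell2P//.
  by rewrite lerXn2r ?nnegrE ?ell2_norm_ge0// ltW.
have sl : l \in square_summable.
  have [x Fx] := Fc 1 ltr01.
  have [sxl _] := sqseries_bounded (near_l _ _ ltr01 Fx).
  have -> : l = ell2_seq x - (ell2_seq x - l) by rewrite subKr.
  by rewrite rpredB// ell2P.
apply/cvg_ex; exists (Ell2 sl); apply/cvgrPdist_lt => e e0.
have e20 : 0 < e / 2 by rewrite divr_gt0.
have e40 : 0 < e / 2 / 2 by rewrite divr_gt0.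
have [x Fx] := Fc _ e40.
have xl : `|x - Ell2 sl| <= e / 2 / 2.
  rewrite ell2_normE -[leRHS](gtr0_norm e40) -sqrtr_sqr.
  by apply: ler_wsqrtr; exact: (sqseries_bounded (near_l _ _ e40 Fx)).2.
apply: filterS (Fx) => y; rewrite -ball_normE/= => xy.
have -> : Ell2 sl - y = (x - y) - (x - Ell2 sl) by rewrite opprB [RHS]addrC subrKA.
apply: le_lt_trans (ler_normB _ _) _; lra.
Qed.

HB.instance Definition _ := Uniform_isComplete.Build (ell2 R) ell2_complete.


End Ell2Type.

Section Widths.
Context {R : realType}.

Section Dimension.
Context {X : lmodType R}.

Definition linearly_independent (k : nat) (e : 'I_k -> X) : Prop :=
  forall c : 'I_k -> R, \sum_i c i *: e i = 0 -> forall i, c i = 0.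

Definition linear_span (k : nat) (e : 'I_k -> X) : set X :=
  [set \sum_i c i *: e i | c in [set: 'I_k -> R]].

Definition subspace_dim (V : set X) (k : nat) : Prop :=
  exists2 e : 'I_k -> X, linearly_independent e & V = linear_span e.

Definition subspace_dim_le (V : set X) (n : nat) : Prop :=
  exists2 k : nat, (k <= n)%N & subspace_dim V k.

Definition centrally_symmetric (K : set X) : Prop :=
  forall x, K x -> K (- x).

End Dimension.

Section Kolmogorov.
Context {X : completeNormedModType R}.
Implicit Types A K V : set X.

(* Infima and suprema are taken in the extended reals, so that an infimum over
   the empty set is +oo. *)
Definition dist_to (f : X) A : \bar R := ereal_inf [set `|f - v|%:E | v in A].

Definition approx_error K A : \bar R := ereal_sup [set dist_to f A | f in K].

Definition kolmogorov_width (n : nat) K : \bar R :=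
  ereal_inf [set approx_error K V | V in [set V | subspace_dim_le V n]].

Definition constrained_kolmogorov_width (n : nat) K : \bar R :=
  ereal_inf [set approx_error K (V `&` K) | V in [set V | subspace_dim_le V n]].

End Kolmogorov.

End Widths.

(* Main.v *)
Require Import Defs.
From HB Require Import structures.
From mathcomp Require Import all_boot all_order all_algebra.
From mathcomp Require Import all_classical all_reals all_analysis.
From mathcomp Require Import ring lra.

Set Implicit Arguments.
Unset Strict Implicit.
Unset Printing Implicit Defensive.

Import Order.TTheory GRing.Theory Num.Theory.
Import numFieldNormedType.Exports.

Local Open Scope classical_set_scope.
Local Open Scope ring_scope.

(* Let N = m + 1 and let K be the absolutely convex hull of N vertices
   f_j = p_j + delta * e_(j+2), where the p_j are widely separated points of a
   parabola in the plane of e_0 and e_1.  That plane approximates K within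
   delta.  Since the points +-p_j are in convex position, an element
   v_i = sum_j c_ij f_j of K (sum_j |c_ij| <= 1) at distance less than 2 from
   f_i has c_ii > 1/2.  If V approximates every vertex this well from within K,
   then (c_ij) is strictly diagonally dominant, hence invertible, and its rows
   are, up to the factor delta, the last N coordinates of vectors of V; so
   dim V >= N > m. *)

(** * Absolutely convex hulls of finitely many points *)

Section AbsoluteConvexHull.
Context {R : realType} {X : normedModType R} {N : nat}.
Implicit Type f : 'I_N -> X.

(** Coefficients are row vectors, so that compactness can be drawn from the topology of
    ['rV[R]_N]. *)
Definition abs_hull f : set X :=
  [set \sum_i c 0 i *: f i | c in [set c : 'rV[R]_N | \sum_i `|c 0 i| <= 1]].

Lemma abs_hull_vertex f i : abs_hull f (f i).
Proof.
exists (delta_mx 0 i) => /=.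
  rewrite (bigD1 i)//= big1 => [|j ji]; rewrite mxE eqxx/=.
    by rewrite eqxx normr1 addr0.
  by rewrite (negbTE ji) normr0.
rewrite (bigD1 i)//= big1 => [|j ji]; rewrite mxE eqxx/=.
  by rewrite eqxx scale1r addr0.
by rewrite (negbTE ji) scale0r.
Qed.

Lemma convex_abs_hull f : convex_set (abs_hull f : set (convex_lmodType X)).
Proof.
move=> x y l; rewrite !inE => -[c /= c1 <-] [d /= d1 <-].
have l0 : 0 <= l%:num by [].
have l1 : 0 <= 1 - l%:num by rewrite subr_ge0.
exists (l%:num *: c + (1 - l%:num) *: d) => /=.
  apply: (@le_trans _ _ (\sum_i (l%:num * `|c 0 i| + (1 - l%:num) * `|d 0 i|))).
    apply: ler_sum => i _; rewrite !mxE; apply: le_trans (ler_normD _ _) _.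
    by rewrite !normrM (ger0_norm l0) (ger0_norm l1).
  by rewrite big_split/= -!mulr_sumr; nra.
rewrite /conv/= !scaler_sumr -big_split/=; apply: eq_bigr => i _.
by rewrite !mxE scalerDl !scalerA.
Qed.

Lemma centrally_symmetric_abs_hull f : centrally_symmetric (abs_hull f).
Proof.
move=> x [c /= c1 <-]; exists (- c) => /=.
  by under eq_bigr do rewrite mxE normrN.
by rewrite -sumrN; apply: eq_bigr => i _; rewrite mxE scaleNr.
Qed.

(** Continuous image of the l^1 unit ball of coefficients, which is a closed subset of the compact
    cube [-1, 1]^N. *)
Lemma compact_abs_hull f : compact (abs_hull f).
Proof.
apply: continuous_compact.
  apply: continuous_subspaceT.
  apply: continuous_big => [|i _ c]; first exact: add_continuous.
  by apply: cvgZr_tmp; [exact: nbhs_filter | exact: coord_continuous].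
have cube : compact [set c : 'rV[R]_N | forall i, `[(-1 : R), 1]%classic (c ord0 i)].
  by apply: (@rV_compact R N (fun=> `[(-1 : R), 1]%classic)) => i; exact: segment_compact.
apply: subclosed_compact cube _.
  apply: (preimage_closed _ (@closed_le _ 1)) => c _.
  apply: continuous_big => [|i _ {}c]; first exact: add_continuous.
  exact: (continuous_comp (@coord_continuous _ _ _ _ _ _) (@norm_continuous _ _ _)).
move=> c /= c1 i; rewrite /= in_itv/= -ler_norml; apply: le_trans c1.
by rewrite (bigD1 i)//= lerDl; apply: sumr_ge0.
Qed.

End AbsoluteConvexHull.

(** * Coordinates and unit vectors of the sequence space *)

Section UnitVectors.
Context {R : realType}.
Implicit Types x y : ell2 R.

Definition unit_seq (k : nat) : nat -> R := fun i => (i == k)%:R.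

Lemma sqseries_unit_seq k n : sqseries (unit_seq k) n <= 1.
Proof.
rewrite /sqseries /series/=.
have -> : \sum_(0 <= i < n) unit_seq k i ^+ 2 = (k < n)%:R.
  elim: n => [|n IH]; first by rewrite big_geq.
  rewrite big_nat_recr//= IH /unit_seq ltnS [(k <= n)%N]leq_eqVlt [n == k]eq_sym.
  by case: (ltngtP k n) => _ /=; rewrite ?expr1n ?expr0n /= ?addr0 ?add0r.
by case: (k < n)%N; rewrite ?ler01.
Qed.

Lemma unit_seq_summable k : unit_seq k \in square_summable.
Proof. exact: (sqseries_bounded (@sqseries_unit_seq k)).1. Qed.

Definition ell2_unit k : ell2 R := Ell2 (unit_seq_summable k).

Lemma ell2_unitE k i : ell2_unit k i = (i == k)%:R.
Proof. by []. Qed.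

Lemma norm_ell2_unit k : `|ell2_unit k| <= 1.
Proof.
rewrite ell2_normE /ell2_norm -[leRHS]sqrtr1; apply: ler_wsqrtr.
exact: (sqseries_bounded (@sqseries_unit_seq k)).2.
Qed.

Lemma ell2D x y k : (x + y) k = x k + y k.
Proof. by []. Qed.

Lemma ell2N x k : (- x) k = - x k.
Proof. by []. Qed.

Lemma ell2Z (a : R) x k : (a *: x) k = a * x k.
Proof. by []. Qed.

Lemma ell2_lincomb (I : Type) (r : seq I) (a : I -> R) (F : I -> ell2 R) k :
  (\sum_(i <- r) a i *: F i) k = \sum_(i <- r) a i * F i k.
Proof. by elim/big_rec2: _ => // i u y _ <-. Qed.

Lemma le_coord_norm x k : `|x k| <= `|x|.
Proof. exact: coord_le_ell2_norm (ell2P x). Qed.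

End UnitVectors.

(** * Linear algebra: strictly dominant matrices and underdetermined systems *)

Section DiagonalDominance.
Context {R : realFieldType}.

(** Levy-Desplanques argument: in a row [i] where [|x i|] is maximal, the diagonal term cannot be
    cancelled by the others unless [x i = 0]. *)
Lemma diag_dominant_ker0 N (c : 'M[R]_N) (x : 'I_N -> R) :
  (forall i, \sum_(j | j != i) `|c i j| < `|c i i|) ->
  (forall i, \sum_j c i j * x j = 0) -> forall i, x i = 0.
Proof.
move=> dom cx0 i0.
have [i _ imax] := @Order.TotalTheory.arg_maxP _ R _ i0 xpredT (fun i => `|x i|) isT.
have xi0 : `|x i| <= 0.
  rewrite leNgt; apply/negP => xi.
  have := cx0 i; rewrite (bigD1 i)//= => /eqP; rewrite addr_eq0 => /eqP E.
  have : `|c i i| * `|x i| <= (\sum_(j | j != i) `|c i j|) * `|x i|.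
    rewrite -normrM E normrN mulr_suml; apply: le_trans (ler_norm_sum _ _ _) _.
    by apply: ler_sum => j _; rewrite normrM ler_wpM2l//; exact: imax.
  by rewrite ler_pM2r// leNgt dom.
by apply/eqP; rewrite -normr_le0; apply: le_trans (imax i0 isT) xi0.
Qed.

(** Rank-nullity: an N x k matrix has rank at most k < N, hence a nonzero left kernel. *)
Lemma exists_common_zero k N (e : 'I_k -> 'I_N -> R) : (k < N)%N ->
  exists2 x : 'I_N -> R, (exists j, x j != 0) &
    forall l, \sum_j e l j * x j = 0.
Proof.
move=> kN; pose E : 'M[R]_(N, k) := \matrix_(j, l) e l j.
have : kermx E != 0.
  rewrite -mxrank_eq0 mxrank_ker -lt0n subn_gt0.
  exact: leq_ltn_trans (rank_leq_col _) kN.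
move=> /rowV0Pn[v vE /rV0Pn[j vj]].
exists (fun j => v 0 j); first by exists j.
move=> l; move/sub_kermxP/rowP: vE => /(_ l); rewrite !mxE => E0.
by rewrite -[RHS]E0; apply: eq_bigr => i _; rewrite mxE mulrC.
Qed.

End DiagonalDominance.

(** * The vertices and the two width estimates *)

Section Vertices.
Context {R : realType} (N : nat) (rho delta : R).
Implicit Types i j : 'I_N.

(** The offset [N%:R ^+ 2] lifts the parabola so that, for [rho > 0], the antipodes -p_j also stay
    below the tangent at every p_i. The shift [j.+2] skips the two coordinates of the plane. *)
Definition vertex (j : 'I_N) : ell2 R :=
  (rho * j%:R) *: ell2_unit 0 + (rho * (N%:R ^+ 2 - j%:R ^+ 2)) *: ell2_unit 1
  + delta *: ell2_unit j.+2.

Lemma vertex0 j : vertex j 0 = rho * j%:R.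
Proof. by rewrite /vertex !ell2D !ell2Z !ell2_unitE/= mulr1 !mulr0 !addr0. Qed.

Lemma vertex1 j : vertex j 1 = rho * (N%:R ^+ 2 - j%:R ^+ 2).
Proof. by rewrite /vertex !ell2D !ell2Z !ell2_unitE/= mulr1 !mulr0 addr0 add0r. Qed.

Lemma vertexSS j i : vertex j i.+2 = delta * (i == j)%:R.
Proof. by rewrite /vertex !ell2D !ell2Z !ell2_unitE/= !mulr0 !add0r. Qed.

(* The first two coordinates of the vertices lie on a parabola; [peak i] is
   the functional of its tangent at vertex [i]. *)
Let peak i (x : ell2 R) : R := 2 * i%:R * x 0 + x 1.
Let height i : R := N%:R ^+ 2 + i%:R ^+ 2.

Let peak_vertex i j :
  peak i (vertex j) = rho * (height i - (i%:R - j%:R) ^+ 2).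
Proof. by rewrite /peak /height vertex0 vertex1; ring. Qed.

Let dist_sq_ge1 i j : i != j -> 1 <= (i%:R - j%:R : R) ^+ 2.
Proof.
move=> ij; have {}ij : nat_of_ord i != j by [].
have H (a b : nat) : (a < b)%N -> 1 <= (b%:R - a%:R : R) ^+ 2.
  by move=> ab; rewrite -natrB ?(ltnW ab)// -natrX ler1n expn_gt0 subn_gt0 ab.
case: (ltngtP i j) ij => // ij _; last exact: H.
by rewrite -sqrrN opprB; exact: H.
Qed.

(** The absolute value treats p_j and -p_j together: the upper bound is (i - j)^2 >= 1, the lower
    one follows from i, j <= N - 1. *)
Let peak_gap i j : i != j -> `|height i - (i%:R - j%:R) ^+ 2| <= height i - 1.
Proof.
move=> ij; have d1 := dist_sq_ge1 ij.
have i0 : (0 : R) <= i%:R by [].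
have j0 : (0 : R) <= j%:R by [].
have i1 : i%:R + 1 <= N%:R :> R by rewrite natr1 ler_nat.
have j1 : j%:R + 1 <= N%:R :> R by rewrite natr1 ler_nat.
by rewrite ler_norml /height; apply/andP; split; nra.
Qed.

(** If [c 0 i <= 2^-1], then [peak i] drops by at least rho/2 = 4N from [vertex i] to the
    combination. But on a vector of norm below 2 it is less than 4i + 2 < 4N; hence the choice of
    [rho]. *)
Lemma coef_gt_half (c : 'rV[R]_N) i : rho = 8 * N%:R ->
  \sum_j `|c 0 j| <= 1 -> `|vertex i - \sum_j c 0 j *: vertex j| < 2 ->
  2^-1 < c 0 i.
Proof.
move=> rhoE c1 near_i; rewrite ltNge; apply/negP => ci.
set v := \sum_j _ in near_i.
have i0 : (0 : R) <= i%:R by [].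
have i1 : i%:R + 1 <= N%:R :> R by rewrite natr1 ler_nat.
have peak_v : peak i v = rho * \sum_j c 0 j * (height i - (i%:R - j%:R) ^+ 2).
  rewrite /peak /v !ell2_lincomb !mulr_sumr -big_split; apply: eq_bigr => j _.
  transitivity (c 0 j * peak i (vertex j)); last by rewrite peak_vertex; ring.
  by rewrite /peak /=; ring.
(* The other coefficients have total mass at most 1 - |c_i|, and each unit of it loses at least 1
   against [height i]. *)
have upper : \sum_j c 0 j * (height i - (i%:R - j%:R) ^+ 2) <= height i - 2^-1.
  rewrite (bigD1 i)//= subrr expr0n/= subr0.
  move: c1; rewrite (bigD1 i)//=; set S := \sum_(j | _) `|_| => c1.
  have S0 : 0 <= S by apply: sumr_ge0.
  have h1 : 1 <= height i by rewrite /height; nra.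
  have : \sum_(j < N | j != i) c 0 j * (height i - (i%:R - j%:R) ^+ 2)
      <= S * (height i - 1).
    rewrite mulr_suml; apply: ler_sum => j ji.
    apply: le_trans (ler_norm _) _; rewrite normrM ler_wpM2l//.
    by apply: peak_gap; rewrite eq_sym.
  have [c0|c0] := lerP 0 (c 0 i); move: c1.
    by rewrite ger0_norm//; nra.
  by rewrite ltr0_norm//; nra.
have n0 := le_coord_norm (vertex i - v) 0.
have n1 := le_coord_norm (vertex i - v) 1.
have a0 := ler_norm ((vertex i - v) 0).
have a1 := ler_norm ((vertex i - v) 1).
have : peak i (vertex i - v) = peak i (vertex i) - peak i v.
  by rewrite /peak !ell2D !ell2N; ring.
rewrite peak_v peak_vertex subrr expr0n/= subr0 -mulrBr => E.
have : 4 * N%:R <= peak i (vertex i - v) by rewrite E rhoE; nra.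
by rewrite /peak; nra.
Qed.

Lemma constrained_width_vertices m : rho = 8 * N%:R -> delta != 0 -> (m < N)%N ->
  (2%:E <= constrained_kolmogorov_width m (abs_hull vertex))%E.
Proof.
move=> rhoE delta0 mN; apply/ereal_infP => _ [V [k km [e _ ->]] <-].
rewrite leNgt; apply/negP => small.
(* An infimum below 2 provides an actual point of both the span and the hull, with coefficients [a]
   and [c] respectively. *)
have near_vertex i : exists (c : 'rV[R]_N) (a : 'I_k -> R),
    [/\ \sum_j `|c 0 j| <= 1, 2^-1 < c 0 i &
        \sum_j c 0 j *: vertex j = \sum_l a l *: e l].
  have : (dist_to (vertex i) (linear_span e `&` abs_hull vertex) < 2%:E)%E.
    apply: le_lt_trans small; apply: ereal_sup_ubound.
    by exists (vertex i) => //; exact: abs_hull_vertex.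
  move=> /ereal_inf_lt[_ [v [[a _ ae] [c /= c1 cv]] <-]]; rewrite lte_fin => d.
  by exists c, a; split => //; [apply: coef_gt_half => //; rewrite cv | rewrite cv].
have [c /choice[a H]] := choice near_vertex.
(* A nonzero [x] orthogonal to coordinates 2, ..., N + 1 of every spanning vector; it will lie in
   the kernel of the dominant matrix, a contradiction. *)
have [x [j xj] x0] := @exists_common_zero R k N (fun l j => e l j.+2)
  (leq_ltn_trans km mN).
apply/negP: xj; rewrite negbK; apply/eqP.
apply: (@diag_dominant_ker0 R N (\matrix_(i, j) c i 0 j)) => i.
  (* Row sums are at most 1 and diagonal entries exceed 1/2, so the off-diagonal mass is below
     1/2. *)
  have [c1 ci _] := H i.
  under eq_bigr do rewrite mxE.
  rewrite mxE; move: c1; rewrite (bigD1 i)//=.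
  by have := ler_norm (c i 0 i); lra.
have [_ _ E] := H i.
(* Only [vertex l] has a nonzero coordinate [l.+2], so this coordinate reads off the coefficient. *)
have cE l : delta * c i 0 l = \sum_(p < k) a i p * e p l.+2.
  transitivity ((\sum_j c i 0 j *: vertex j) l.+2); last by rewrite E ell2_lincomb.
  rewrite ell2_lincomb; under eq_bigr do rewrite vertexSS.
  rewrite (bigD1 l)//= eqxx mulr1 mulrC big1 ?addr0// => s sl.
  by rewrite eq_sym -val_eqE /= in sl *; rewrite (negbTE sl) !mulr0.
apply: (mulfI delta0); rewrite mulr0 mulr_sumr.
under eq_bigr do rewrite mxE mulrA cE mulr_suml.
rewrite exchange_big/= big1// => p _.
by under eq_bigr do rewrite -mulrA; rewrite -mulr_sumr x0 mulr0.
Qed.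

Lemma width_vertices n : 0 <= delta -> (2 <= n)%N ->
  (kolmogorov_width n (abs_hull vertex) <= delta%:E)%E.
Proof.
move=> delta0 n2; pose e (l : 'I_2) : ell2 R := ell2_unit l.
apply: (@le_trans _ _ (approx_error (abs_hull vertex) (linear_span e))).
  apply: ereal_inf_lbound; exists (linear_span e) => //.
  exists 2%N => //; exists e => // a a0 l.
  have : (\sum_i a i *: e i) l = 0 by rewrite a0.
  rewrite ell2_lincomb; under eq_bigr do rewrite ell2_unitE.
  rewrite (bigD1 l)//= eqxx mulr1 big1 ?addr0// => s sl.
  by rewrite eq_sym -val_eqE /= in sl *; rewrite (negbTE sl) mulr0.
apply/ereal_supP => _ [_ [c /= c1 <-] <-].
(* Coordinates of the projection onto the plane; the remainder is a combination of vectors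
   [delta *: ell2_unit j.+2] with the same coefficients. *)
pose a (l : 'I_2) := if l == 0 then \sum_j c 0 j * (rho * j%:R)
  else \sum_j c 0 j * (rho * (N%:R ^+ 2 - j%:R ^+ 2)).
apply: (@le_trans _ _ `|\sum_j c 0 j *: vertex j - \sum_l a l *: e l|%:E).
  by apply: ereal_inf_lbound; exists (\sum_l a l *: e l) => //; exists a.
rewrite lee_fin.
have -> : \sum_j c 0 j *: vertex j - \sum_l a l *: e l =
    \sum_j (c 0 j * delta) *: ell2_unit j.+2.
  rewrite big_ord_recl big_ord1 /a /e/= !scaler_suml -big_split/= -sumrB.
  apply: eq_bigr => j _; rewrite /vertex !scalerDr !scalerA.
  by rewrite [X in X - _]addrC addrK.
apply: le_trans (ler_norm_sum _ _ _) _.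
apply: (@le_trans _ _ (\sum_j `|c 0 j| * delta)).
  apply: ler_sum => j _; rewrite normrZ normrM (ger0_norm delta0).
  by apply: ler_piMr; [exact: mulr_ge0 | exact: norm_ell2_unit].
by rewrite -mulr_suml ler_piMl.
Qed.

End Vertices.

Theorem theorem4p7 (R : realType) (eps : R) (n m : nat)
    (eps_gt0 : 0 < eps) (n_ge2 : (2 <= n)%N) (m_ge_n : (n <= m)%N) :
  exists K : set (ell2 R),
    [/\ convex_set K, centrally_symmetric K, compact K,
        (kolmogorov_width n K < eps%:E)%E &
        (1%:E < constrained_kolmogorov_width m K)%E].
Proof.
have eps20 : 0 < eps / 2 by rewrite divr_gt0.
(* m + 1 vertices exceed any dimension allowed; [eps / 2] and the bound 2 leave room for both strict
   inequalities. *)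
exists (abs_hull (@vertex R m.+1 (8 * m.+1%:R) (eps / 2))); split.
- exact: convex_abs_hull.
- exact: centrally_symmetric_abs_hull.
- exact: compact_abs_hull.
- apply: le_lt_trans (width_vertices _ _ (ltW eps20) n_ge2) _.
  by rewrite lte_fin; lra.
- apply: lt_le_trans (constrained_width_vertices (erefl _) _ (ltnSn m)).
    by rewrite lte_fin ltr1n.
  by rewrite gt_eqF.
Qed.
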